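(* Let $a<b$ be real numbers, let $K\ge 2$, $\mathcal{I}=\{1,\dots,K\}$, and let $D_{cdf}([a,b])$ be the set of cdfs $F$ on $\mathbb{R}$ with $F(a-)=0$ and $F(b)=1$. Let $\mathscr{D}\subseteq D_{cdf}([a,b])$ be nonempty and convex. Let $\mathsf{T}:D_{cdf}([a,b])\to\mathbb{R}$ satisfy, for some $C>0$, $|\mathsf{T}(F)-\mathsf{T}(G)|\le C\|F-G\|_\infty$ for all $F\in\mathscr{D}$, $G\in D_{cdf}([a,b])$. Suppose $\mathscr{D}$ contains $H_1,H_2$ such that $J_\tau:=\tau H_1+(1-\tau)H_2\in\mathscr{D}$ for all $\tau\in[0,1]$ and, for some $c_->0$, $\mathsf{T}(J_{\tau_2})-\mathsf{T}(J_{\tau_1})\ge c_-(\tau_2-\tau_1)$ for all $0\le\tau_1\le\tau_2\le 1$. Let $\mathscr{M}_K$ be a closed subset of the simplex $\mathscr{S}_K$ with at least two elements. Then there exists a constant $c>0$, independent of $K$, $n$ and $\mathscr{M}_K$, such that for every policy $\pi$ with recommendations in $\mathscr{M}_K$ and every randomization measure $\mathbb{P}_G$, $$\sup_{F^1,\dots,F^K\in\{J_\tau:\tau\in[0,1]\}}\mathbb{E}[r_n(\pi,\mathscr{M}_K)]\ge c\,\mathrm{diam}^2(\mathscr{M}_K)/\sqrt{n}\quad\text{for every } n\ge K,$$ where the supremum is over all potential outcome distributions with independent marginals having cdfs $F^1,\dots,F^K$ in $\{J_\tau:\tau\in[0,1]\}$, and $\mathrm{diam}(\mathscr{M}_K)=\max\{\|\nu-\gamma\|:\nu,\gamma\in\mathscr{M}_K\}$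 (Euclidean norm).
   Context: $\|F-G\|_\infty=\sup_x|F(x)-G(x)|$. $\mathscr{S}_K=\{\delta\in[0,1]^K:\sum_i\delta_i=1\}$. For $\delta\in\mathscr{S}_K$ and $\mathbf{F}=(F^1,\dots,F^K)$, $\langle\delta,\mathbf{F}\rangle=\sum_i\delta_iF^i$. Setting: potential outcome vectors $Y_t=(Y_{1,t},\dots,Y_{K,t})$, $t\in\mathbb{N}$, are i.i.d., with $Y_{i,t}$ having cdf $F^i$; randomization variables $G_t$, $t\in\mathbb{N}$, are i.i.d. with distribution $\mathbb{P}_G$ (the randomization measure) and independent of $(Y_t)$. A policy $\pi$ with recommendations in $\mathscr{M}_K$ is a triangular array of measurable maps: for each $n\ge K$, $\pi_{n,t}:([a,b]\times\mathbb{R})^{t-1}\times\mathbb{R}\to\mathcal{I}$ for $t=1,\dots,n$ and $\pi_{n,n+1}:([a,b]\times\mathbb{R})^n\times\mathbb{R}\to\mathscr{M}_K$. Inputs are defined recursively: $(Z_0,G_1)=(G_1)$ and $Z_{t-1}=(Y_{\pi_{n,t-1}(Z_{t-2},G_{t-1}),t-1},G_{t-1},\dots,Y_{\pi_{n,1}(G_1),1},G_1)$; subject $t$ is assigned to treatment $\pi_{n,t}(Z_{t-1},G_t)$ and the final recommendation is $\pi_{n,n+1}(Z_n,G_{n+1})$. The regret is $r_n(\pi,\mathscr{M}_K)=\max_{\delta\in\mathscr{M}_K}\mathsf{T}(\langle\delta,\mathbf{F}\rangle)-\mathsf{T}(\langle\pi_{n,n+1}(Z_n,G_{n+1}),\mathbf{F}\rangle)$.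 *)

(* Defs.v *)
From HB Require Import structures.
From mathcomp Require Import all_boot all_order all_algebra.
From mathcomp Require Import all_classical all_reals all_analysis.
Set Implicit Arguments. Unset Strict Implicit. Unset Printing Implicit Defensive.
Import Order.TTheory GRing.Theory Num.Theory.
Import numFieldNormedType.Exports.
Local Open Scope classical_set_scope.
Local Open Scope ring_scope.

Section defs.
Variable R : realType.

Definition is_cdf (F : R -> R) : Prop :=
  {homo F : x y / x <= y} /\
  (forall x, (F y @[y --> x^'+] --> F x)) /\
  (F x @[x --> -oo] --> (0 : R)) /\
  (F x @[x --> +oo] --> (1 : R)).

Definition Dcdf (a b : R) : set (R -> R) :=
  [set F | is_cdf F /\ (F x @[x --> a^'-] --> (0 : R)) /\ F b = 1].

Definition supnorm (F G : R -> R) : R := sup (range (fun x => `|F x - G x|)).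

Definition convex_cdfset (D : set (R -> R)) : Prop :=
  forall F G l, D F -> D G -> 0 <= l <= 1 ->
    D (fun x => l * F x + (1 - l) * G x).

Definition simplexS (K : nat) : set ('I_K -> R) :=
  [set d | (forall i, 0 <= d i <= 1) /\ \sum_(i < K) d i = 1].

Definition mixcdf (K : nat) (d : 'I_K -> R) (F : 'I_K -> R -> R) : R -> R :=
  fun x => \sum_(i < K) d i * F i x.

Definition eucl (K : nat) (d : 'I_K -> R) : R := Num.sqrt (\sum_(i < K) d i ^+ 2).
Definition diamM (K : nat) (M : set ('I_K -> R)) : R :=
  sup [set eucl (fun i => u i - v i) | u in M & v in M].

Definition cdf_of (P : probability R R) : R -> R :=
  fun x => fine (P [set y | y <= x]).

(** A policy: pol_step n t is pi_{n,t+1}, taking Z_t (t past pairs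
    (outcome, randomization), in chronological order) and G_{t+1};
    pol_rec n is pi_{n,n+1}. *)
Record policy (K : nat) := Policy {
  pol_step : forall n t : nat, (t.-tuple (R * R) * R)%type -> 'I_K ;
  pol_rec  : forall n : nat, (n.-tuple (R * R) * R)%type -> ('I_K -> R) }.
Arguments pol_step {K} p n t _.
Arguments pol_rec {K} p n _.

Definition valid_policy (K : nat) (M : set ('I_K -> R)) (pi : policy K) : Prop :=
  (forall n t (i : 'I_K), measurable [set x | pol_step pi n t x = i]) /\
  (forall n (i : 'I_K), measurable_fun [set: (n.-tuple (R * R) * R)%type]
                          (fun x => pol_rec pi n x i)) /\
  (forall n x, M (pol_rec pi n x)).

Definition regret_n (T : (R -> R) -> R) (K : nat) (M : set ('I_K -> R))
    (F : 'I_K -> R -> R) (d : 'I_K -> R) : R :=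
  sup [set T (mixcdf e F) | e in M] - T (mixcdf d F).

Section expected_regret.
Variables (T : (R -> R) -> R) (K : nat) (M : set ('I_K -> R)) (pi : policy K)
  (n : nat) (nu : 'I_K -> probability R R) (PG : probability R R).

Let F : 'I_K -> R -> R := fun i => cdf_of (nu i).

(** pvalue m t h : conditional expected regret_n given history h of length t,
    with m subjects still to be treated *)
Fixpoint pvalue (m t : nat) (h : t.-tuple (R * R)) {struct m} : \bar R :=
  match m with
  | 0 => match (insub (tval h) : option (n.-tuple (R * R))) with
         | Some h' => (\int[PG]_g (regret_n T M F (pol_rec pi n (h', g)))%:E)%E
         | None => 0%E
         end
  | m'.+1 => (\int[PG]_g \int[nu (pol_step pi n t (h, g))]_y
                 pvalue m' [tuple of rcons h (y, g)])%E
  end.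

(** E[r_n(pi, M)] when the outcome Y_{i,t} has law nu i, the coordinates of
    Y_t are independent, (Y_t) i.i.d., and (G_t) i.i.d. with law PG,
    independent of (Y_t). *)
Definition exp_regret : \bar R := pvalue n [tuple].

End expected_regret.

End defs.

(* Main.v *)
Require Import Defs.
From HB Require Import structures.
From mathcomp Require Import all_boot all_order all_algebra.
From mathcomp Require Import all_classical all_reals all_analysis.
From mathcomp Require Import measurable_realfun ring lra.
Import Order.TTheory GRing.Theory Num.Theory.
Import numFieldNormedType.Exports.
Local Open Scope classical_set_scope.
Local Open Scope ring_scope.

(**
Take [u, v] in [M] almost realizing the diameter, put [w = u - v], and let arm
[i] have law [J_(1/2 + e w_i)] in one environment and [J_(1/2 - e w_i)] in the
other.  In terms of the mixing weights, the two values of a recommendation [d]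
are [1/2 + e <d, w>] and [1/2 - e <d, w>], so the two regrets of [d] are
nonnegative and add up to at least [cm e |w|^2], whatever [d] is.
Drawing from [J_tau] means tossing a [tau]-coin and then drawing from [H1] or
[H2], hence one observation is no more informative than one toss of a coin of
bias [1/2 + e w_i] or [1/2 - e w_i], whose Hellinger affinity is at least
[1 - 4 e^2] for every arm.  With [e] of order [1 / sqrt n] the affinity of the
whole experiment stays bounded below, independently of the number of arms, and
Le Cam's two-point argument applies.
*)

(** * Laws with a given cdf, mixtures of laws, integral lower bounds *)

Lemma is_cdf_probability (R : realType) (F : R -> R) :
  is_cdf F -> exists P : probability R R, cdf_of P = F.
Proof.
move=> [ndF [rcF [F0 F1]]].
pose H1 := isCumulative.Build R _ R F ndF rcF.
pose H2 := isCumulativeBounded.Build R 0 1 F F0 F1.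
pose f : cumulativeBounded (0 : R) (1 : R) := HB.pack F H1 H2.
(* The Stieltjes measure of [F] lives on [measurableTypeR R]; its distribution under the identity is
   the required law on [R]. *)
pose idR : measurableTypeR R -> R := idfun.
pose mid := isMeasurableFun.Build _ _ _ _ idR (@measurable_id _ _ setT).
pose X : {mfun measurableTypeR R >-> R} := HB.pack idR mid.
exists (distribution (lebesgue_stieltjes_measure f) X).
apply/funext => x; rewrite /cdf_of.
have /(congr1 fine) /= := cdf_lebesgue_stieltjes_id f x.
by rewrite set_itvE.
Qed.

(** The integral formula is the rigorous form of tossing a [t]-coin and then drawing from [P] or
    [Q]. *)
Lemma probability_convex (R : realType) (P Q : probability R R) (t : R) :
  0 <= t <= 1 -> exists N : probability R R,
    cdf_of N = (fun x => t * cdf_of P x + (1 - t) * cdf_of Q x) /\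
    forall f : R -> \bar R, (forall x, (0 <= f x)%E) -> measurable_fun [set: R] f ->
      (\int[N]_x f x = t%:E * \int[P]_x f x + (1 - t)%:E * \int[Q]_x f x)%E.
Proof.
move=> /andP[t0 t1]; have t1' : 0 <= 1 - t by rewrite subr_ge0.
pose mP := mscale (NngNum t0) P; pose mQ := mscale (NngNum t1') Q.
pose m : {measure set R -> \bar R} := measure_add mP mQ.
have mE (A : set R) : (m A = t%:E * P A + (1 - t)%:E * Q A)%E.
  exact: measure_addE.
have mT : m setT = 1%E.
  by rewrite mE !probability_setT !mule1 -EFinD addrC subrK.
pose m_prob := Measure_isProbability.Build _ _ _ m mT.
pose N : probability R R := HB.pack (Measure.sort m) m_prob.
exists N; split.
  apply/funext => x; rewrite /cdf_of.
  have mx : measurable [set y : R | y <= x].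
    by have := measurable_itv `]-oo, x]; rewrite set_itvE.
  rewrite [N _]mE fineD ?fineM//; try exact: fin_num_measure.
  - by rewrite fin_numM// fin_num_measure.
  - by rewrite fin_numM// fin_num_measure.
move=> f f0 mf; rewrite [LHS](ge0_integral_measure_add mP mQ)//.
by rewrite /mP /mQ !ge0_integral_mscale.
Qed.

Lemma integral_probability_ge (d : measure_display) (U : measurableType d)
    (R : realType) (P : probability U R) (f : U -> \bar R) (k : R) :
  (forall x, (0 <= f x)%E) -> measurable_fun [set: _] f ->
  (forall x, (k%:E <= f x)%E) -> (k%:E <= \int[P]_x f x)%E.
Proof.
(* Monotonicity of the integral is used for nonnegative functions only, so a negative [k] is settled
   by the sign of the integral. *)
move=> f0 mf kf; have [k0|k0] := leP 0 k; last first.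
  by apply: (@le_trans _ _ 0%E); [rewrite lee_fin ltW|exact: integral_ge0].
apply: (@le_trans _ _ (\int[P]_x (cst k%:E x))%E).
  rewrite integral_cst//= [X in (_ * X)%E](_ : _ = 1%E) ?mule1//.
  exact: probability_setT.
by apply: ge0_le_integral => //; move=> x _; rewrite lee_fin.
Qed.

(** * Measurability of the conditional expected regret *)

Lemma measurable_rcons (d d' : measure_display) (U : measurableType d)
    (V : measurableType d') (n : nat) (f : U -> n.-tuple V) (g : U -> V) :
  measurable_fun setT f -> measurable_fun setT g ->
  measurable_fun setT (fun x => [tuple of rcons (f x) (g x)]).
Proof.
move=> mf mg; apply/measurable_fun_tnthP => i.
have [->|i_max] := eqVneq i ord_max.
  apply: eq_measurable_fun mg => x _ /=.
  by rewrite (tnth_nth (g x)) /= nth_rcons size_tuple ltnn eqxx.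
have ltin : (i < n)%N.
  by rewrite ltn_neqAle -ltnS ltn_ord andbT.
have := (measurable_fun_tnthP f).1 mf (Ordinal ltin).
apply: eq_measurable_fun => x _ /=.
by rewrite !(tnth_nth (g x)) /= nth_rcons size_tuple ltin.
Qed.

Section pvalue_measurability.
Context {R : realType} {K : nat} (T : (R -> R) -> R) (M : set ('I_K -> R))
  (pi : policy R K) (n : nat) (nu : 'I_K -> probability R R)
  (PG : probability R R).
Hypothesis pi_valid : valid_policy M pi.

Let regret := regret_n T M (fun i => cdf_of (nu i)).
Hypothesis regret_ge0 : forall d, M d -> 0 <= regret d.
Hypothesis measurable_regret :
  measurable_fun setT (fun x : n.-tuple (R * R) * R => regret (pol_rec pi x)).

Let V := @pvalue R T K M pi n nu PG.

(** At length [n] the [insub] in [pvalue] succeeds, so its default value 0 never enters a full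
    run. *)
Lemma pvalue_full (h : n.-tuple (R * R)) :
  V 0 n h = (\int[PG]_g (regret (pol_rec pi (h, g)))%:E)%E.
Proof. by rewrite /V /= valK. Qed.

Lemma pvalue_ge0 m t (h : t.-tuple (R * R)) : (0 <= V m t h)%E.
Proof.
elim: m t h => [|m IH] t h; last first.
  rewrite /V /=; apply: integral_ge0 => g _.
  by apply: integral_ge0 => y _; exact: IH.
rewrite /V /=; case: insubP => [h' _ _|_]//.
apply: integral_ge0 => g _; rewrite lee_fin; apply: regret_ge0.
exact: (pi_valid.2.2).
Qed.

Lemma measurable_pvalue_rcons m t (i : 'I_K) :
  measurable_fun setT (V m t.+1) ->
  measurable_fun setT (fun x : t.-tuple (R * R) * R =>
    (\int[nu i]_y V m t.+1 [tuple of rcons x.1 (y, x.2)])%E).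
Proof.
move=> mV; pose f (z : (t.-tuple (R * R) * R) * R) :=
  V m t.+1 [tuple of rcons z.1.1 (z.2, z.1.2)].
apply: (measurable_fun_fubini_tonelli_F (m2 := nu i) f).
  apply: (measurableT_comp mV); apply: measurable_rcons.
    by apply: measurableT_comp.
  apply: measurable_fun_pair; first exact: measurable_snd.
  by apply: measurableT_comp.
by move=> z; exact: pvalue_ge0.
Qed.

Lemma measurable_pvalue_step m t :
  measurable_fun setT (V m t.+1) ->
  measurable_fun setT (fun x : t.-tuple (R * R) * R =>
    (\int[nu (pol_step pi n x)]_y V m t.+1 [tuple of rcons x.1 (y, x.2)])%E).
Proof.
move=> mV.
(* The integrating law varies with [x], but only through the selected arm: split over the finitely
   many arms, each with a fixed law. *)
have -> : (fun x : t.-tuple (R * R) * R =>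
    (\int[nu (pol_step pi n x)]_y V m t.+1 [tuple of rcons x.1 (y, x.2)])%E) =
  (fun x => (\sum_(i < K) if pol_step pi n x == i then
     \int[nu i]_y V m t.+1 [tuple of rcons x.1 (y, x.2)] else 0)%E).
  by apply/funext => x; rewrite -big_mkcond /= (big_pred1 (pol_step pi n x)).
apply: emeasurable_sum => i; apply: measurable_fun_ifT => //.
- apply: (measurable_fun_bool true); rewrite setTI.
  rewrite (_ : _ @^-1` _ = [set x | pol_step pi n x = i]); first exact: pi_valid.1.
  by apply/seteqP; split => x /= /eqP.
- exact: measurable_pvalue_rcons.
Qed.

Lemma measurable_pvalue m t : (t + m)%N = n -> measurable_fun setT (V m t).
Proof.
elim: m t => [|m IH] t tn.
  rewrite addn0 in tn; subst t.
  rewrite (_ : V 0 n = fun h => (\int[PG]_g (regret (pol_rec pi (h, g)))%:E)%E);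
    last by apply/funext => h; exact: pvalue_full.
  apply: (measurable_fun_fubini_tonelli_F (m2 := PG)
    (fun x : n.-tuple (R * R) * R => (regret (pol_rec pi x))%:E)).
    exact/measurable_EFinP.
  move=> x; rewrite lee_fin; apply: regret_ge0; exact: (pi_valid.2.2).
have /IH/measurable_pvalue_step mV : (t.+1 + m = n)%N by rewrite addSnnS.
apply: (measurable_fun_fubini_tonelli_F (m2 := PG) _ mV) => x.
by apply: integral_ge0 => y _; exact: pvalue_ge0.
Qed.

End pvalue_measurability.

(** * Inequalities behind one step of the two-point argument *)

Lemma integral_lincomb_ge (d : measure_display) (U : measurableType d)
    (R : realType) (P : probability U R) (f g : U -> \bar R) (p q k : R) :
  0 <= p -> 0 <= q ->
  (forall x, (0 <= f x)%E) -> measurable_fun setT f ->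
  (forall x, (0 <= g x)%E) -> measurable_fun setT g ->
  (forall x, (k%:E <= p%:E * f x + q%:E * g x)%E) ->
  (k%:E <= p%:E * \int[P]_x f x + q%:E * \int[P]_x g x)%E.
Proof.
move=> p0 q0 f0 mf g0 mg kfg.
have pf0 x : (0 <= p%:E * f x)%E by rewrite mule_ge0// lee_fin.
have qg0 x : (0 <= q%:E * g x)%E by rewrite mule_ge0// lee_fin.
have mpf : measurable_fun setT (fun x => p%:E * f x)%E by exact: measurable_funeM.
have mqg : measurable_fun setT (fun x => q%:E * g x)%E by exact: measurable_funeM.
rewrite -ge0_integralZl_EFin// -(ge0_integralZl_EFin _ _ _ mg)// -ge0_integralD//.
apply: integral_probability_ge => //; last exact: emeasurable_funD.
by move=> x; rewrite adde_ge0.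
Qed.

(** The right side is at least [D * min p q]. If [p <= q], then
    [(p + q / 4)^2 - p * q = (p - q / 4)^2], so [sqrt (p * q) - (p + q) / 4 <= p]. *)
Lemma weighted_sum_ge_sqrt (R : realType) (p q x y D : R) :
  0 <= p -> 0 <= q -> 0 <= x -> 0 <= y -> 0 <= D -> D <= x + y ->
  D * (Num.sqrt (p * q) - (p + q) / 4) <= p * x + q * y.
Proof.
wlog pq : p q x y / p <= q.
  move=> H p0 q0 x0 y0 D0 Dxy; have [pq|/ltW qp] := leP p q; first exact: H.
  by rewrite (mulrC p q) (addrC p q) (addrC (p * x)); apply: H; rewrite 1?addrC.
move=> p0 q0 x0 y0 D0 Dxy.
have sE : Num.sqrt (p * q) <= p + q / 4.
  have r0 : 0 <= p + q / 4 by lra.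
  rewrite -[leRHS](ger0_norm r0) -sqrtr_sqr ler_sqrt ?sqr_ge0//.
  have := sqr_ge0 (p - q / 4); lra.
move: (Num.sqrt _) sE => s sE.
have : D * (s - (p + q) / 4) <= D * p by apply: ler_wpM2l => //; lra.
by move/le_trans; apply; nra.
Qed.

(** Contribution of one side of the coin to the affinity; the two sides together give the factor
    [1 - 4 * e ^+ 2]. It rests on [1 / 4 - dl ^+ 2 >= (1 - 4 * e ^+ 2) / 4] and on [sqrt z >= z] for
    [z] in [0, 1]. *)
Lemma sqrt_affinity_ge (R : realType) (p q e dl : R) :
  0 <= p -> 0 <= q -> 0 <= e <= 1 / 4 -> `|dl| <= e ->
  (1 - 4 * e ^+ 2) / 2 * Num.sqrt (p * q) <=
  Num.sqrt ((p * (1 / 2 + dl)) * (q * (1 / 2 - dl))).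
Proof.
move=> p0 q0 /andP[e0 e1]; rewrite ler_norml => /andP[d0 d1].
have -> : (p * (1 / 2 + dl)) * (q * (1 / 2 - dl)) = (1 / 4 - dl ^+ 2) * (p * q).
  by field.
have dle : dl ^+ 2 <= e ^+ 2 by nra.
have e2 : e ^+ 2 <= 1 / 16 by nra.
have e2' : 0 <= e ^+ 2 by exact: sqr_ge0.
rewrite [leRHS]sqrtrM; last by lra.
apply: ler_wpM2r; first exact: sqrtr_ge0.
have r0 : 0 <= (1 - 4 * e ^+ 2) / 2 by lra.
rewrite -[leLHS](ger0_norm r0) -sqrtr_sqr ler_sqrt; last by lra.
by move: (e ^+ 2) (dl ^+ 2) dle e2 e2' => u v; nra.
Qed.

(** Regroups by the side of the coin: index 1 carries the updated likelihoods [p * a], [q * b],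
    index 2 carries [p * b], [q * a]. Nonnegativity makes distributivity valid in the extended
    reals. *)
Lemma mule_two_mixtures (R : realType) (p q a b : R) (A1 A2 B1 B2 : \bar R) :
  0 <= a -> 0 <= b -> (0 <= A1)%E -> (0 <= A2)%E -> (0 <= B1)%E -> (0 <= B2)%E ->
  (p%:E * (a%:E * A1 + b%:E * A2) + q%:E * (b%:E * B1 + a%:E * B2) =
   ((p * a)%:E * A1 + (q * b)%:E * B1) + ((p * b)%:E * A2 + (q * a)%:E * B2))%E.
Proof.
move=> a0 b0 A10 A20 B10 B20.
by rewrite !ge0_muleDr ?mule_ge0 ?lee_fin// !muleA -!EFinM addeACA.
Qed.

(** * Le Cam's two-point bound, by induction on the remaining subjects *)

Section two_environments.
Context {R : realType} {K : nat} (T : (R -> R) -> R) (M : set ('I_K -> R))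
  (pi : policy R K) (n : nat) (nup num : 'I_K -> probability R R)
  (PG mu1 mu2 : probability R R) (dl : 'I_K -> R) (e D : R).
Hypothesis pi_valid : valid_policy M pi.

Let rp := regret_n T M (fun i => cdf_of (nup i)).
Let rm := regret_n T M (fun i => cdf_of (num i)).
Hypothesis rp_ge0 : forall d, M d -> 0 <= rp d.
Hypothesis rm_ge0 : forall d, M d -> 0 <= rm d.
Hypothesis mrp :
  measurable_fun setT (fun x : n.-tuple (R * R) * R => rp (pol_rec pi x)).
Hypothesis mrm :
  measurable_fun setT (fun x : n.-tuple (R * R) * R => rm (pol_rec pi x)).
Hypothesis e_itv : 0 <= e <= 1 / 4.
Hypothesis dl_le : forall i, `|dl i| <= e.
Hypothesis nupE : forall i (f : R -> \bar R), (forall x, (0 <= f x)%E) ->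
  measurable_fun setT f ->
  (\int[nup i]_x f x = (1 / 2 + dl i)%:E * \int[mu1]_x f x +
                       (1 / 2 - dl i)%:E * \int[mu2]_x f x)%E.
Hypothesis numE : forall i (f : R -> \bar R), (forall x, (0 <= f x)%E) ->
  measurable_fun setT f ->
  (\int[num i]_x f x = (1 / 2 - dl i)%:E * \int[mu1]_x f x +
                       (1 / 2 + dl i)%:E * \int[mu2]_x f x)%E.
Hypothesis D_ge0 : 0 <= D.
Hypothesis D_le : forall d, M d -> D <= rp d + rm d.

Let Vp := @pvalue R T K M pi n nup PG.
Let Vm := @pvalue R T K M pi n num PG.

(* [p] and [q] are the likelihoods of the past in the two environments.  The
   bound is a linearization of Le Cam's [min >= affinity^2 / 2], chosen so that
   it propagates through one step: [p + q] is preserved on average, while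
   [sqrt (p * q)] shrinks by at most the affinity of one toss. *)
Lemma two_point_pvalue_ge m t (h : t.-tuple (R * R)) (p q : R) :
  (t + m)%N = n -> 0 <= p -> 0 <= q ->
  ((D * ((1 - 4 * e ^+ 2) ^+ m * Num.sqrt (p * q) - (p + q) / 4))%:E <=
   p%:E * Vp m t h + q%:E * Vm m t h)%E.
Proof.
elim: m t h p q => [|m IH] t h p q tn p0 q0.
  rewrite addn0 in tn; subst t.
  rewrite /Vp /Vm !pvalue_full; apply: integral_lincomb_ge => //.
  - by move=> g; rewrite lee_fin; apply: rp_ge0; exact: (pi_valid.2.2).
  - apply/measurable_EFinP.
    exact: (measurableT_comp mrp (measurable_pair1 h)).
  - by move=> g; rewrite lee_fin; apply: rm_ge0; exact: (pi_valid.2.2).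
  - apply/measurable_EFinP.
    exact: (measurableT_comp mrm (measurable_pair1 h)).
  move=> g; rewrite -!EFinM -EFinD lee_fin expr0 mul1r.
  have Mx := pi_valid.2.2 n (h, g).
  by apply: weighted_sum_ge_sqrt => //; [exact: rp_ge0|exact: rm_ge0|exact: D_le].
have tn' : (t.+1 + m = n)%N by rewrite addSnnS.
have mVp : measurable_fun setT (Vp m t.+1) by exact: measurable_pvalue.
have mVm : measurable_fun setT (Vm m t.+1) by exact: measurable_pvalue.
have Vp0 s (k : s.-tuple (R * R)) : (0 <= Vp m s k)%E by exact: pvalue_ge0.
have Vm0 s (k : s.-tuple (R * R)) : (0 <= Vm m s k)%E by exact: pvalue_ge0.
rewrite [Vp _ _ _]/= [Vm _ _ _]/=; apply: integral_lincomb_ge => //.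
- by move=> g; apply: integral_ge0 => y _; exact: Vp0.
- have mp : measurable_fun setT (fun x : t.-tuple (R * R) * R =>
    (\int[nup (pol_step pi n x)]_y Vp m t.+1 [tuple of rcons x.1 (y, x.2)])%E).
    exact: measurable_pvalue_step.
  exact: (measurableT_comp mp (measurable_pair1 h)).
- by move=> g; apply: integral_ge0 => y _; exact: Vm0.
- have mp : measurable_fun setT (fun x : t.-tuple (R * R) * R =>
    (\int[num (pol_step pi n x)]_y Vm m t.+1 [tuple of rcons x.1 (y, x.2)])%E).
    exact: measurable_pvalue_step.
  exact: (measurableT_comp mp (measurable_pair1 h)).
(* With [h] and [g] fixed, both environments use the same arm [i]; only the bias of its coin
   differs. *)
move=> g; set i := pol_step pi n (h, g).
pose A y := Vp m t.+1 [tuple of rcons h (y, g)].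
pose B y := Vm m t.+1 [tuple of rcons h (y, g)].
have mrc : measurable_fun setT (fun y : R => [tuple of rcons h (y, g)]).
  by apply: measurable_rcons => //; apply: measurable_fun_pair.
have mA : measurable_fun setT A by exact: measurableT_comp mVp mrc.
have mB : measurable_fun setT B by exact: measurableT_comp mVm mrc.
have A0 y : (0 <= A y)%E by exact: Vp0.
have B0 y : (0 <= B y)%E by exact: Vm0.
rewrite [X in (p%:E * X)%E](nupE i A)// [X in (q%:E * X)%E](numE i B)//.
have := dl_le i; rewrite ler_norml => /andP[dl1 dl2].
have /andP[e0 e1] := e_itv.
have a0 : 0 <= 1 / 2 + dl i by lra.
have b0 : 0 <= 1 / 2 - dl i by lra.
have IA (mu : probability R R) : (0 <= \int[mu]_y A y)%E by exact: integral_ge0.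
have IB (mu : probability R R) : (0 <= \int[mu]_y B y)%E by exact: integral_ge0.
rewrite mule_two_mixtures//.
(* The induction hypothesis at the updated likelihoods, averaged over an outcome whose law [mu] is
   common to both environments. *)
have step (mu : probability R R) (a b : R) : 0 <= a -> 0 <= b ->
  ((D * ((1 - 4 * e ^+ 2) ^+ m * Num.sqrt ((p * a) * (q * b)) -
         (p * a + q * b) / 4))%:E
   <= (p * a)%:E * \int[mu]_y A y + (q * b)%:E * \int[mu]_y B y)%E.
  move=> a0' b0'; apply: integral_lincomb_ge => //; try exact: mulr_ge0.
  by move=> y; apply: IH => //; exact: mulr_ge0.
(* Both sides of the coin are added: the biases sum to 1, so the linear terms recombine into
   [p + q], and each square root keeps at least [(1 - 4 * e ^+ 2) / 2] of [sqrt (p * q)]. *)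
apply: le_trans (leeD (step mu1 _ _ a0 b0) (step mu2 _ _ b0 a0)).
rewrite -EFinD lee_fin -mulrDr; apply: ler_wpM2l => //.
have s1 := sqrt_affinity_ge _ _ _ _ _ p0 q0 e_itv (dl_le i).
have s2 : (1 - 4 * e ^+ 2) / 2 * Num.sqrt (p * q) <=
    Num.sqrt ((p * (1 / 2 - dl i)) * (q * (1 / 2 + dl i))).
  have := sqrt_affinity_ge _ p q e (- dl i) p0 q0 e_itv.
  by rewrite normrN opprK; exact.
have r0 : 0 <= (1 - 4 * e ^+ 2) ^+ m by apply: exprn_ge0; nra.
have := lerD (ler_wpM2l r0 s1) (ler_wpM2l r0 s2).
rewrite [_ ^+ m.+1]exprS; lra.
Qed.

End two_environments.

(** * Regret when every arm lies on the segment [J] *)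

Section regret_on_segment.
Context {R : realType} (T : (R -> R) -> R) (H1 H2 : R -> R) (cm : R).

Let J (tau : R) : R -> R := fun x => tau * H1 x + (1 - tau) * H2 x.
Hypothesis cm_gt0 : 0 < cm.
Hypothesis TJ_incr : forall t1 t2, 0 <= t1 -> t1 <= t2 -> t2 <= 1 ->
  cm * (t2 - t1) <= T (J t2) - T (J t1).

Context {K : nat} (M : set ('I_K -> R)) (tau : 'I_K -> R).
Hypothesis M_simplex : M `<=` @simplexS R K.
Hypothesis tau_itv : forall i, 0 <= tau i <= 1.

Let val (d : 'I_K -> R) := \sum_(i < K) d i * tau i.
Let regret := regret_n T M (fun i => J (tau i)).

(** [J] is affine in its parameter and the weights sum to 1; a recommendation thus matters only
    through the scalar [val d]. *)
Lemma mixcdf_segment d : M d -> mixcdf d (fun i => J (tau i)) = J (val d).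
Proof.
move=> /M_simplex[_ d1]; apply/funext => x; rewrite /mixcdf /J /val.
rewrite -[1 in RHS]d1 -sumrB !mulr_suml -big_split /=.
by apply: eq_bigr => i _; ring.
Qed.

Lemma mixing_weight_itv d : M d -> 0 <= val d <= 1.
Proof.
move=> /M_simplex[d01 d1]; apply/andP; split.
  apply: sumr_ge0 => i _; apply: mulr_ge0.
    by have /andP[] := d01 i.
  by have /andP[] := tau_itv i.
rewrite -d1; apply: ler_sum => i _; have /andP[d0 _] := d01 i.
by have /andP[_ t1] := tau_itv i; rewrite -[leRHS]mulr1 ler_wpM2l.
Qed.

Lemma TJ_homo s t : 0 <= s -> s <= t -> t <= 1 -> T (J s) <= T (J t).
Proof.
move=> s0 st t1; rewrite -subr_ge0; apply: le_trans (TJ_incr _ _ s0 st t1).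
by rewrite mulr_ge0 ?subr_ge0// ltW.
Qed.

Lemma regret_ge_diff d f : M d -> M f -> T (J (val f)) - T (J (val d)) <= regret d.
Proof.
move=> Md Mf; rewrite /regret /regret_n mixcdf_segment// lerB//.
apply: ub_le_sup; last by exists f => //; rewrite mixcdf_segment.
(* [sup] is meaningful only for a set bounded above; monotonicity along the segment supplies the
   bound [T (J 1)]. *)
exists (T (J 1)) => _ [g Mg <-]; rewrite mixcdf_segment//.
by have /andP[v0 v1] := mixing_weight_itv _ Mg; apply: TJ_homo.
Qed.

Lemma regret_segment_ge0 d : M d -> 0 <= regret d.
Proof. by move=> Md; have := regret_ge_diff _ _ Md Md; rewrite subrr. Qed.

(** Any [f] in [M] may serve as comparison, so no maximizer has to be identified; when
    [val f <= val d] the left side is nonpositive. *)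
Lemma regret_segment_ge d f : M d -> M f -> cm * (val f - val d) <= regret d.
Proof.
move=> Md Mf; have [df|/ltW fd] := leP (val d) (val f).
  apply: le_trans (regret_ge_diff _ _ Md Mf).
  have /andP[d0 _] := mixing_weight_itv _ Md.
  by have /andP[_ f1] := mixing_weight_itv _ Mf; exact: TJ_incr.
apply: le_trans (regret_segment_ge0 _ Md).
by rewrite mulr_ge0_le0 ?subr_le0// ltW.
Qed.

Lemma measurable_regret_segment (d : measure_display) (U : measurableType d)
    (g : U -> 'I_K -> R) :
  (forall x, M (g x)) -> (forall i, measurable_fun setT (fun x => g x i)) ->
  measurable_fun setT (fun x => regret (g x)).
Proof.
move=> Mg mg.
(* Measurability comes from monotonicity of [s] to [T (J s)] on [0, 1]; clamping extends it to a
   monotone function on the line without changing it at [val (g x)]. *)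
pose clamp (s : R) := Num.max 0 (Num.min s 1).
have clamp_itv s : 0 <= clamp s <= 1.
  by rewrite /clamp le_max lexx/= ge_max ler01/= ge_min lexx orbT.
have mT : measurable_fun setT (fun s => T (J (clamp s))).
  apply: nondecreasing_measurable => // s t st; apply: TJ_homo.
  - by have /andP[] := clamp_itv s.
  - by apply: Order.TotalTheory.le_max2 => //; apply: Order.TotalTheory.le_min2.
  - by have /andP[] := clamp_itv t.
rewrite (_ : (fun x => _) = (fun x =>
  sup [set T (mixcdf f (fun i => J (tau i))) | f in M] - T (J (clamp (val (g x)))))).
  apply: measurable_funB => //.
  apply: (measurableT_comp mT); apply: measurable_sum => i.
  exact: measurable_funM.
apply/funext => x; rewrite /regret /regret_n mixcdf_segment//.
have /andP[v0 v1] := mixing_weight_itv _ (Mg x).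
by rewrite /clamp min_l// max_r.
Qed.

End regret_on_segment.

(** * Diameter of a subset of the simplex, and Bernoulli's inequality *)

Lemma simplex_entry_diff_le1 (R : realType) (K : nat) (u v : 'I_K -> R) i :
  simplexS u -> simplexS v -> `|u i - v i| <= 1.
Proof.
move=> [/(_ i)/andP[u0 u1] _] [/(_ i)/andP[v0 v1] _].
by rewrite ler_norml; apply/andP; split; lra.
Qed.

(** Some pair lies at more than half the supremum when it is positive, and squaring gives the factor
    4; at diameter 0 a point is paired with itself. *)
Lemma half_diam_attained (R : realType) (K : nat) (M : set ('I_K -> R)) :
  M `<=` @simplexS R K -> M !=set0 -> exists u v, [/\ M u, M v &
    diamM M ^+ 2 <= 4 * \sum_(i < K) (u i - v i) ^+ 2].
Proof.
move=> MS [u0 Mu0]; rewrite /diamM.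
set E := [set _ | _ in _ & _ in _].
have Eu0 : E (eucl (fun i => u0 i - u0 i)) by exists u0 => //; exists u0.
have supE : has_sup E.
  split; first by eexists; exact: Eu0.
  exists (Num.sqrt K%:R) => _ [u Mu [v Mv <-]]; apply: ler_wsqrtr.
  rewrite -[X in X%:R]card_ord -sum1_card natr_sum.
  apply: ler_sum => i _; rewrite -[_ ^+ 2]ger0_norm ?sqr_ge0// normrX.
  by rewrite expr_le1//; apply: simplex_entry_diff_le1; exact: MS.
have sE0 : 0 <= sup E.
  by apply: le_trans (ub_le_sup supE.2 Eu0); exact: sqrtr_ge0.
have sqE (u v : 'I_K -> R) :
    eucl (fun i => u i - v i) ^+ 2 = \sum_(i < K) (u i - v i) ^+ 2.
  by rewrite sqr_sqrtr// sumr_ge0// => i _; exact: sqr_ge0.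
have [s0|s0] := ltP 0 (sup E); last first.
  have -> : sup E = 0 by apply/le_anti; rewrite s0 sE0.
  exists u0, u0; split => //; rewrite expr0n/= mulr_ge0// sumr_ge0// => i _.
  exact: sqr_ge0.
have [_ [u Mu [v Mv <-]] suv] := sup_adherent (divr_gt0 s0 (ltr0n R 2)) supE.
exists u, v; split => //; rewrite -sqE.
by move: (eucl _) (sup E) suv s0 => x s; nra.
Qed.

Lemma bernoulli_inequality (R : realType) (x : R) n :
  0 <= x <= 1 -> 1 - n%:R * x <= (1 - x) ^+ n.
Proof.
move=> /andP[x0 x1]; elim: n => [|n IH]; first by rewrite mul0r subr0 expr0.
rewrite exprS -natr1.
have : (1 - x) * (1 - n%:R * x) <= (1 - x) * (1 - x) ^+ n.
  by apply: ler_wpM2l => //; lra.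
apply: le_trans; have : 0 <= n%:R :> R by []; nra.
Qed.

(** * Choice of the two environments and of the constants *)

Theorem theorem3p1 (R : realType) (a b : R) (D : set (R -> R))
  (T : (R -> R) -> R) (C cm : R) (H1 H2 : R -> R) :
  a < b ->
  D !=set0 -> D `<=` Dcdf a b -> convex_cdfset D ->
  0 < C ->
  (forall F G, D F -> Dcdf a b G -> `|T F - T G| <= C * supnorm F G) ->
  D H1 -> D H2 ->
  (forall tau, 0 <= tau <= 1 -> D (fun x => tau * H1 x + (1 - tau) * H2 x)) ->
  0 < cm ->
  (forall t1 t2, 0 <= t1 -> t1 <= t2 -> t2 <= 1 ->
     T (fun x => t2 * H1 x + (1 - t2) * H2 x)
     - T (fun x => t1 * H1 x + (1 - t1) * H2 x) >= cm * (t2 - t1)) ->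
  exists c : R, 0 < c /\
    forall (K : nat), (2 <= K)%N ->
    forall M : set ('I_K -> R),
      @closed {ptws 'I_K -> R} M -> M `<=` @simplexS R K -> (exists u v, M u /\ M v /\ u <> v) ->
    forall n : nat, (K <= n)%N ->
    forall pi : policy R K, valid_policy M pi ->
    forall PG : probability R R,
      ((c * diamM M ^+ 2 / Num.sqrt n%:R)%:E <=
       ereal_sup [set exp_regret T M pi n nu PG | nu in
         [set nu : 'I_K -> probability R R | forall i, exists tau : R,
            (0 <= tau <= 1)%R /\
            cdf_of (nu i) = (fun x => tau * H1 x + (1 - tau) * H2 x)%R]])%E.
Proof.
move=> _ _ DS _ _ _ D1 D2 _ cm0 TJ.
have [mu1 mu1E] := is_cdf_probability _ _ (DS _ D1).1.
have [mu2 mu2E] := is_cdf_probability _ _ (DS _ D2).1.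
(* 128 is the product of 4 from the two-point bound, 4 from [e], 4 from the diameter and 2 from
   splitting the sum between two environments. *)
exists (cm / 128); split; first by rewrite divr_gt0.
move=> K K2 M _ MS [u0 [_ [Mu0 _]]] n Kn pi pi_valid PG.
have [u [v [Mu Mv diam_uv]]] := half_diam_attained _ _ _ MS (ex_intro _ u0 Mu0).
have n1 : 1 <= n%:R :> R by rewrite ler1n (leq_trans _ Kn)// (leq_trans _ K2).
set sn := Num.sqrt n%:R.
have sn1 : 1 <= sn by rewrite -[leLHS]sqrtr1 ler_sqrt ?ler0n.
have snE : sn ^+ 2 = n%:R by rewrite sqr_sqrtr ?ler0n.
have sn0 : sn != 0 by rewrite gt_eqF// (lt_le_trans ltr01).
(* This keeps all biases in [1/4, 3/4] and makes [4 * n * e^2] equal to 1/4. *)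
pose e := (4 * sn)^-1.
have esn : e * sn = 1 / 4 by rewrite /e; field.
have e_itv : 0 <= e <= 1 / 4.
  have e0 : 0 <= e by rewrite invr_ge0; lra.
  by apply/andP; split => //; nra.
pose w i := u i - v i; set W := \sum_(i < K) _ in diam_uv.
have W0 : 0 <= W by rewrite sumr_ge0// => i _; exact: sqr_ge0.
have dl_le i : `|e * w i| <= e.
  have /andP[e0 _] := e_itv; rewrite normrM ger0_norm// ler_piMr//.
  by apply: simplex_entry_diff_le1; exact: MS.
pose taup i := 1 / 2 + e * w i; pose taum i := 1 / 2 - e * w i.
have taup_itv i : 0 <= taup i <= 1.
  have := dl_le i; rewrite ler_norml /taup => /andP[? ?].
  by have /andP[? ?] := e_itv; apply/andP; split; lra.
have taum_itv i : 0 <= taum i <= 1.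
  have := dl_le i; rewrite ler_norml /taum => /andP[? ?].
  by have /andP[? ?] := e_itv; apply/andP; split; lra.
have [nup nupP] := choice (fun i => probability_convex _ mu1 mu2 _ (taup_itv i)).
have [num numP] := choice (fun i => probability_convex _ mu1 mu2 _ (taum_itv i)).
have cdfp : (fun i => cdf_of (nup i)) =
    (fun i x => taup i * H1 x + (1 - taup i) * H2 x).
  by apply/funext => i; rewrite (nupP i).1 mu1E mu2E.
have cdfm : (fun i => cdf_of (num i)) =
    (fun i x => taum i * H1 x + (1 - taum i) * H2 x).
  by apply/funext => i; rewrite (numP i).1 mu1E mu2E.
have rec_in x : M (pol_rec pi (n := n) x) by exact: pi_valid.2.2.
have mrec i : measurable_fun setT (fun x => pol_rec pi (n := n) x i).
  exact: pi_valid.2.1.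
have /andP[e0 e1] := e_itv.
have D0 : 0 <= cm * (e * W) by rewrite !mulr_ge0// ltW.
have sum_regret d : M d -> cm * (e * W) <=
    regret_n T M (fun i => cdf_of (nup i)) d +
    regret_n T M (fun i => cdf_of (num i)) d.
  move=> Md; rewrite cdfp cdfm.
  (* Comparing with [u] in the first environment and with [v] in the second, the contributions of
     [d] cancel and [e * W] remains. *)
  have rp := regret_segment_ge T H1 H2 cm cm0 TJ M taup MS taup_itv d u Md Mu.
  have rm := regret_segment_ge T H1 H2 cm cm0 TJ M taum MS taum_itv d v Md Mv.
  apply: le_trans (lerD rp rm); rewrite -mulrDr; apply: ler_wpM2l; first exact: ltW.
  have [_ d1] := MS _ Md; have [_ u1] := MS _ Mu; have [_ v1] := MS _ Mv.
  have valp f : \sum_(i < K) f i * taup i =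
      (\sum_(i < K) f i) / 2 + e * \sum_(i < K) f i * w i.
    rewrite mulr_suml mulr_sumr -big_split.
    by apply: eq_bigr => i _; rewrite /taup /=; ring.
  have valm f : \sum_(i < K) f i * taum i =
      (\sum_(i < K) f i) / 2 - e * \sum_(i < K) f i * w i.
    rewrite mulr_suml mulr_sumr -sumrB.
    by apply: eq_bigr => i _; rewrite /taum /=; ring.
  rewrite !valp !valm d1 u1 v1.
  have -> : W = \sum_(i < K) u i * w i - \sum_(i < K) v i * w i.
    by rewrite -sumrB; apply: eq_bigr => i _; rewrite -mulrBl expr2.
  by lra.
have sum_ge : ((cm * (e * W) / 4)%:E <=
    exp_regret T M pi n nup PG + exp_regret T M pi n num PG)%E.
  have := two_point_pvalue_ge T M pi n nup num PG mu1 mu2 (fun i => e * w i) e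
    (cm * (e * W)) pi_valid _ _ _ _ e_itv dl_le _ _ D0 sum_regret
    n 0 [tuple] 1 1 erefl ler01 ler01.
  rewrite !mul1e => two_point; apply: le_trans (two_point _ _ _ _ _ _).
  (* At [p = q = 1] the bracket is [(1 - 4 * e ^+ 2) ^+ n - 1 / 2]; Bernoulli bounds the power below
     by 3/4, leaving 1/4. *)
  - rewrite lee_fin ler_wpM2l//.
    have x_itv : 0 <= 4 * e ^+ 2 <= 1 by apply/andP; split; nra.
    have := bernoulli_inequality _ _ n x_itv.
    rewrite -snE mulrCA -exprMn (mulrC sn) esn mulr1 sqrtr1 mulr1; lra.
  - by move=> d; rewrite cdfp; exact: (regret_segment_ge0 T H1 H2 cm).
  - by move=> d; rewrite cdfm; exact: (regret_segment_ge0 T H1 H2 cm).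
  - by rewrite cdfp; apply: (measurable_regret_segment T H1 H2 cm).
  - by rewrite cdfm; apply: (measurable_regret_segment T H1 H2 cm).
  - move=> i f f0 mf; rewrite (nupP i).2// /taup.
    by rewrite (_ : 1 - (1 / 2 + _) = 1 / 2 - e * w i)//; field.
  - move=> i f f0 mf; rewrite (numP i).2// /taum.
    by rewrite (_ : 1 - (1 / 2 - _) = 1 / 2 + e * w i)//; field.
have in_class (nu : 'I_K -> probability R R) (tau : 'I_K -> R) :
    (forall i, 0 <= tau i <= 1) ->
    (fun i => cdf_of (nu i)) = (fun i x => tau i * H1 x + (1 - tau i) * H2 x) ->
  forall i, exists tau : R, (0 <= tau <= 1)%R /\
    cdf_of (nu i) = (fun x => tau * H1 x + (1 - tau) * H2 x).
  by move=> tau01 nuE i; exists (tau i); split => //; exact: (congr1 (@^~ i) nuE).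
set c := (X in (X%:E <= _)%E).
have c_le : c + c <= cm * (e * W) / 4.
  have eE : e = sn^-1 / 4 by rewrite /e; field.
  have -> : c = cm * sn^-1 / 128 * diamM M ^+ 2 by rewrite /c; field.
  have k0 : 0 <= cm * sn^-1 / 128.
    by rewrite divr_ge0// mulr_ge0 ?(ltW cm0)// invr_ge0 (le_trans ler01).
  by have := ler_wpM2l k0 diam_uv; rewrite eE; lra.
(* If both expected regrets were below [c], their sum would be below [c + c], contradicting
   [sum_ge]. *)
have [cp|pc] := leP c%:E (exp_regret T M pi n nup PG).
  apply: le_trans cp _; apply: ereal_sup_ubound.
  by exists nup => //; exact: in_class cdfp.
have [cm'|mc] := leP c%:E (exp_regret T M pi n num PG).
  apply: le_trans cm' _; apply: ereal_sup_ubound.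
  by exists num => //; exact: in_class cdfm.
have := le_lt_trans sum_ge (lteD pc mc).
by rewrite -EFinD lte_fin ltNge c_le.
Qed.
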